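(* Let $f(x) = \sum_{n=0}^{\infty} a_n x^n$, where $(a_n)_{n\ge 0}$ is a $C^2$-finite sequence of order $r$ and degree $k$, satisfying $$C_{r,n}a_{n+r} + C_{r-1,n}a_{n+r-1}+ \dots + C_{0,n}a_{n} = 0 \qquad (n \ge 0).$$ Then $f(x)$ satisfies a (non-homogeneous) linear differential equation with polynomial coefficients of the form $$\sum_{\alpha} \left[ q_{\alpha,0}(x)f(\alpha x)+ q_{\alpha,1}(x)f'(\alpha x) + \dots + q_{\alpha,r'}(x)f^{(r')}(\alpha x)\right] = R(x),$$ where $\alpha$ ranges over the roots of the characteristic polynomials of the $C$-finite coefficient sequences $C_{i,n}$, $0 \le i \le r$. Here the order $r'$ is at most $k$, the degree of the polynomial $q_{\alpha,t}(x)$ is at most $r+k$ for each $\alpha$ and $t$, and the degree of the polynomial $R(x)$ is at most $r-1$.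
   Context: Sequences are indexed by $n=0,1,2,\dots$ and have complex values; generating functions are formal power series. A sequence $(C_n)_{n\ge0}$ is $C$-finite if it satisfies a homogeneous linear recurrence with constant coefficients $C_{n+d} + c_{d-1}C_{n+d-1}+\dots+c_0 C_n=0$ for all $n\ge 0$; its characteristic polynomial is $N^d+c_{d-1}N^{d-1}+\dots+c_0$. A closed-form formula for such a sequence is $C_n=\sum_{\alpha\in S}p_\alpha(n)\alpha^n$, where $S$ is the set of roots of the characteristic polynomial and the $p_\alpha$ are polynomials. $Deg(C_n)$ denotes the highest degree of the $p_\alpha(n)$, $\alpha\in S$. A sequence $(a_n)_{n\ge 0}$ is $C^2$-finite if it is defined by a linear recurrence with $C$-finite sequence coefficients $$C_{r,n}a_{n+r} + C_{r-1,n}a_{n+r-1}+ \dots + C_{0,n}a_{n} = 0,$$ where each $(C_{i,n})_{n\ge0}$ is $C$-finite and $C_{r,n}\neq 0$ for all $n=0,1,2,\dots$, along with initial values $a_0,\dots,a_{r-1}$. It is said to have order $r$ and degree $k$ if it satisfies such a recurrence in which $Deg(C_{i,n})\le k$ for each $0\le i\le r$. Notation: $f^{(j)}(\alpha x)$ means $\dfrac{d^j f(\alpha x)}{dx^j}$, i.e. the $j$-th derivative with respect to $x$ of the composite $x\mapsto f(\alpha x)$ (and $f'(\alpha x)$ is the case $j=1$). *)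

(* Defs.v *)
From mathcomp Require Import all_boot all_order all_algebra.
From mathcomp Require Import all_classical reals.
From mathcomp Require Export complex.

Set Implicit Arguments.
Unset Strict Implicit.
Unset Printing Implicit Defensive.
Import Order.TTheory GRing.Theory Num.Theory.
Local Open Scope classical_set_scope.
Local Open Scope ring_scope.

Section CFinite.
Variable K : fieldType.
Implicit Types (chi : {poly K}) (c : nat -> K).

(* With chi = N^d + c_(d-1) N^(d-1) + ... + c_0 (so size chi = d.+1), the sum
   is c_(n+d) + c_(d-1) c_(n+d-1) + ... + c_0 c_n. *)
Definition has_charpoly chi c : Prop :=
  chi \is monic /\
  forall n : nat, \sum_(j < size chi) chi`_j * c (n + j)%N = 0.

(* The sum has finite support since chi != 0.  By convention 0 ^+ 0 = 1. *)
Definition closed_form chi c (p : K -> {poly K}) : Prop :=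
  forall n : nat,
    c n = \sum_(alpha \in [set z | root chi z]) (p alpha).[n%:R] * alpha ^+ n.

(* Deg(c_n) <= k.  At a nonzero root alpha the polynomial p alpha is determined
   by c; at alpha = 0 only the value (p 0).[0] matters, which is why the p alpha
   are quantified existentially. *)
Definition Deg_le chi c (k : nat) : Prop :=
  exists p : K -> {poly K},
    closed_form chi c p /\
    forall alpha : K, root chi alpha -> (size (p alpha) <= k.+1)%N.

End CFinite.

(* A formal power series is the function nat -> K of its coefficients. *)
Section FormalPowerSeries.
Variable K : fieldType.
Implicit Types (f : nat -> K) (q : {poly K}).

Definition fps_scale (alpha : K) f : nat -> K := fun n => alpha ^+ n * f n.

Definition fps_deriv f : nat -> K := fun n => f n.+1 *+ n.+1.

Definition fps_polymul q f : nat -> K :=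
  fun n => \sum_(i < n.+1) q`_i * f (n - i)%N.

(* f^(j)(alpha x), the j-th derivative of the composite x |-> f(alpha x). *)
Definition fps_deriv_scale (j : nat) (alpha : K) f : nat -> K :=
  iter j fps_deriv (fps_scale alpha f).

End FormalPowerSeries.

(* Main.v *)
Require Import Defs.
From mathcomp Require Import all_boot all_order all_algebra.
From mathcomp Require Import all_classical reals complex.
Import Order.TTheory GRing.Theory Num.Theory.
Local Open Scope classical_set_scope.
Local Open Scope ring_scope.
Local Open Scope complex_scope.

(** The coefficient of x^m in x^t f^(t)(alpha x) is m(m-1)...(m-t+1) alpha^m a_m.
    So if the values D(m) of an exponential polynomial are written as combinations
    of terms m(m-1)...(m-t+1) alpha^m (falling factorials are a basis of the
    polynomials), then the series with coefficients D(m) a_m is a combination of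
    the x^t f^(t)(alpha x), with constant coefficients.

    Suppose first that 0 is not a root of any characteristic polynomial.  Then the
    index of C_i can be shifted: for alpha <> 0, the summand p(n) alpha^n of C_i(n)
    is a polynomial in n+i times alpha^(n+i), so C_i(n) = D_i(n+i) for such a D_i
    ([closed_form_shift]).  The operator sum_i x^(r-i) D_i applied to f has, as its
    coefficient of x^(n+r), the sum of the C_i(n) a_(n+i), which vanishes by the
    recurrence ([shift_operator_eq0]); only the powers of x below r remain, and they
    make up R.  The power x^(r-i) and the power x^t that goes with the t-th
    derivative give degrees at most r+k.  Were all these coefficients zero, D_r and
    hence C_r would vanish, against the hypothesis on C_r.

    If 0 is a root of some characteristic polynomial, the summand 0^n is supported
    at n = 0 and cannot be shifted.  But then f(0 x) is among the admissible terms
    and is the constant a_0, so f(0 x) = a_0 is an equation of the required form. *)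

(** * Formal power series *)

Lemma fps_polymul_lincomb (K : fieldType) (I : finType) (c : I -> K)
    (q : I -> {poly K}) (f : nat -> K) (n : nat) :
  fps_polymul (\sum_i c i *: q i) f n = \sum_i c i * fps_polymul (q i) f n.
Proof.
rewrite /fps_polymul.
under eq_bigr => j _ do rewrite coef_sum mulr_suml.
rewrite exchange_big /=; apply: eq_bigr => i _; rewrite mulr_sumr.
by apply: eq_bigr => j _; rewrite coefZ mulrA.
Qed.

Lemma fps_polymul0 (K : fieldType) (f : nat -> K) (n : nat) :
  fps_polymul 0 f n = 0.
Proof. by rewrite /fps_polymul big1 // => i _; rewrite coef0 mul0r. Qed.

Lemma fps_polymulXn (K : fieldType) (d : nat) (f : nat -> K) (n : nat) :
  fps_polymul 'X^d f n = if (d <= n)%N then f (n - d)%N else 0.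
Proof.
rewrite /fps_polymul; case: leqP => [led|ltd].
  have ltd : (d < n.+1)%N by [].
  rewrite (bigD1 (Ordinal ltd)) //= coefXn eqxx mul1r big1 ?addr0 // => i.
  by rewrite -val_eqE /= coefXn => /negbTE ->; rewrite mul0r.
rewrite big1 // => i _; rewrite coefXn ltn_eqF ?mul0r //.
exact: leq_trans (ltn_ord i) ltd.
Qed.

Lemma fps_deriv_scaleE (K : fieldType) (t : nat) (alpha : K) (f : nat -> K)
    (n : nat) :
  fps_deriv_scale t alpha f n =
  ((n + t) ^_ t)%:R * alpha ^+ (n + t) * f (n + t)%N.
Proof.
rewrite /fps_deriv_scale; elim: t n => [|t IHt] n.
  by rewrite /= addn0 ffactn0 mul1r.
rewrite iterS /fps_deriv IHt addSnnS -[LHS]mulr_natl !mulrA -natrM.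
by rewrite [in RHS]ffactnSr addnS -addSn addnK [(n.+1 * _)%N]mulnC.
Qed.

(** The falling factorial vanishes for m < t, so the formula also covers the
    coefficients below x^t, where the multiplication by x^t produces zeros. *)
Lemma fps_polymulXn_deriv_scale (K : fieldType) (d t : nat) (alpha : K)
    (f : nat -> K) (m : nat) :
  fps_polymul 'X^(d + t) (fps_deriv_scale t alpha f) (m + d) =
  (m ^_ t)%:R * alpha ^+ m * f m.
Proof.
rewrite fps_polymulXn addnC leq_add2r; case: leqP => [letm|ltmt].
  by rewrite subnDr fps_deriv_scaleE subnK.
by rewrite ffact_small // !mul0r.
Qed.

Lemma fps_deriv_scale0 (K : fieldType) (f : nat -> K) (n : nat) :
  fps_deriv_scale 0 0 f n = if n == 0%N then f 0%N else 0.
Proof.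
rewrite fps_deriv_scaleE addn0 ffactn0 mul1r expr0n.
by case: n => [|n] /=; rewrite ?mul1r ?mul0r.
Qed.

(** * Closed forms in the falling factorial basis *)

(** Peeling off the value at 0, p = c + X q, the expansion of q(X+1) at n - 1
    gives that of X q at n, since n (n-1)^_t = n^_(t+1). *)
Lemma falling_factorial_expansion (K : fieldType) (k : nat) (p : {poly K}) :
  (size p <= k.+1)%N ->
  exists b : nat -> K,
    forall n : nat, p.[n%:R] = \sum_(t < k.+1) b t * (n ^_ t)%:R.
Proof.
elim: k p => [|k IHk] p.
  move=> /size1_polyC ->; exists (fun=> p`_0) => n.
  by rewrite hornerC big_ord1 ffactn0 mulr1.
elim/poly_ind: p => [|q c _].
  by move=> _; exists (fun=> 0) => n; rewrite horner0 big1 // => t _; rewrite mul0r.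
rewrite size_MXaddC => szq.
have [|b bP] := IHk (q \Po ('X + 1%:P)).
  rewrite size_comp_poly2 ?size_XaddC //.
  by case: ifP szq => [/andP[/eqP -> _]|_]; rewrite ?size_poly0.
exists (fun t => if t is u.+1 then b u else c) => n.
rewrite big_ord_recl ffactn0 mulr1 hornerMXaddC addrC; congr (_ + _).
case: n => [|n].
  by rewrite mulr0 big1 // => t _; rewrite lift0 ffact0n mulr0.
have -> : q.[n.+1%:R] = (q \Po ('X + 1%:P)).[n%:R].
  by rewrite horner_comp hornerD hornerX hornerC mulrS addrC.
rewrite bP mulr_suml; apply: eq_bigr => t _.
by rewrite lift0 ffactSS natrM -mulrA [(n ^_ t)%:R * _]mulrC.
Qed.

(** Here alpha <> 0 is what allows alpha^n to be replaced by alpha^(-i) alpha^(n+i),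
    and likewise the polynomial at n to be re-expanded as a polynomial in n + i. *)
Lemma closed_form_shift (K : fieldType) (chi : {poly K}) (c : nat -> K)
    (k i : nat) (S : set K) :
  finite_set S -> [set z | root chi z] `<=` S -> ~ S 0 -> Deg_le chi c k ->
  exists b : K -> nat -> K, forall n : nat,
    c n = \sum_(alpha \in S)
            \sum_(t < k.+1) b alpha t * ((n + i) ^_ t)%:R * alpha ^+ (n + i).
Proof.
move=> finS rootS S0 [p [cE szp]].
have /choice[b bP] : forall alpha : K, exists b : nat -> K, root chi alpha ->
    forall n : nat, (p alpha).[n%:R] = \sum_(t < k.+1) b t * ((n + i) ^_ t)%:R.
  move=> alpha; have [r_alpha|nr] := boolP (root chi alpha); last by exists (fun=> 0).
  have [|b bP] := @falling_factorial_expansion K k (p alpha \Po ('X - i%:R%:P)).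
    by rewrite size_comp_poly2 ?size_XsubC // szp.
  exists b => _ n; rewrite -bP horner_comp hornerXsubC natrD.
  by rewrite addrK.
(* S may contain roots of other characteristic polynomials, where p is arbitrary. *)
exists (fun alpha t => if root chi alpha then b alpha t / alpha ^+ i else 0) => n.
rewrite cE (eq_fsbigr (fun alpha => \sum_(t < k.+1)
    (if root chi alpha then b alpha t / alpha ^+ i else 0) *
    ((n + i) ^_ t)%:R * alpha ^+ (n + i))); last first.
  move=> alpha /[!inE] /= r_alpha.
  have alpha0 : alpha != 0.
    by apply: contra_notN S0 => /eqP <-; apply: rootS.
  rewrite bP // mulr_suml r_alpha; apply: eq_bigr => t _.
  rewrite exprD [alpha ^+ n * _]mulrC mulrA; congr (_ * _).
  by rewrite -!mulrA; congr (_ * _); rewrite mulrC mulfK // expf_neq0.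
apply: fsbig_widen => // alpha [_ /= /negP/negbTE ->].
by rewrite big1 // => t _; rewrite !mul0r.
Qed.

Lemma finite_roots (K : fieldType) (p : {poly K}) :
  p != 0 -> finite_set [set z | root p z].
Proof.
move=> p0; apply: contrapT => /(infinite_set_fset (size p))[B Bp].
apply/negP; rewrite -ltnNge.
apply: (max_poly_roots p0); last exact: finmap.fset_uniq.
by apply/allP => z /Bp.
Qed.

(** * The differential operator of a recurrence *)

(** With C_i(n) = D_i(n+i), this is the coefficient of f^(t)(alpha x) in
    sum_i x^(r-i) D_i, where [c i] lists the coefficients of D_i at alpha. *)
Definition shift_operator_coef (K : fieldType) (r : nat)
    (c : 'I_r.+1 -> nat -> K) (t : nat) : {poly K} :=
  \sum_(i < r.+1) c i t *: 'X^(r - i + t).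

Lemma size_shift_operator_coef (K : fieldType) (r k : nat)
    (c : 'I_r.+1 -> nat -> K) (t : nat) :
  (t <= k)%N -> (size (shift_operator_coef K r c t) <= (r + k).+1)%N.
Proof.
move=> letk; apply: leq_trans (size_sum _ _ _) _; apply/bigmax_leqP => i _.
apply: leq_trans (size_scale_leq _ _) _.
by rewrite size_polyXn ltnS leq_add // leq_subr.
Qed.

(** Distinct i contribute distinct powers of x, so c_r shows up undisturbed. *)
Lemma coef_shift_operator_coef_max (K : fieldType) (r : nat)
    (c : 'I_r.+1 -> nat -> K) (t : nat) :
  (shift_operator_coef K r c t)`_t = c ord_max t.
Proof.
rewrite coef_sum (bigD1 ord_max) //= subnn coefZ coefXn eqxx mulr1.
rewrite big1 ?addr0 // => i; rewrite -val_eqE /= => i_neq.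
rewrite coefZ coefXn -[X in X == _]add0n eqn_add2r.
by rewrite ltn_eqF ?mulr0 // subn_gt0 ltn_neqAle i_neq -ltnS ltn_ord.
Qed.

Lemma shift_operator_eq0 (K : fieldType) (r k : nat) (S : set K)
    (c : K -> 'I_r.+1 -> nat -> K) (C : 'I_r.+1 -> nat -> K) (a : nat -> K) :
  finite_set S ->
  (forall (i : 'I_r.+1) (n : nat), C i n = \sum_(alpha \in S)
     \sum_(t < k.+1) c alpha i t * ((n + i) ^_ t)%:R * alpha ^+ (n + i)) ->
  (forall n : nat, \sum_(i < r.+1) C i n * a (n + i)%N = 0) ->
  forall n : nat, \sum_(alpha \in S) \sum_(t < k.+1)
    fps_polymul (shift_operator_coef K r (c alpha) t)
      (fps_deriv_scale t alpha a) (n + r)%N = 0.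
Proof.
move=> finS CE a_rec n; rewrite -[RHS](a_rec n) fsbig_finite //=.
under [RHS]eq_bigr => i _ do rewrite CE fsbig_finite //= mulr_suml.
rewrite [RHS]exchange_big /=; apply: eq_bigr => alpha _.
under [RHS]eq_bigr => i _ do rewrite mulr_suml.
rewrite [RHS]exchange_big /=; apply: eq_bigr => t _.
rewrite fps_polymul_lincomb; apply: eq_bigr => i _.
have -> : (n + r = (n + i) + (r - i))%N by rewrite -addnA subnKC // -ltnS.
by rewrite fps_polymulXn_deriv_scale !mulrA.
Qed.

(** * The differential equation *)

Theorem theorem17 (R : realType) (r k : nat) (a : nat -> R[i])
    (C : 'I_r.+1 -> nat -> R[i]) (chi : 'I_r.+1 -> {poly R[i]})
    (C_charpoly : forall i : 'I_r.+1, has_charpoly (chi i) (C i))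
    (C_deg : forall i : 'I_r.+1, Deg_le (chi i) (C i) k)
    (C_lead : forall n : nat, C ord_max n <> 0)
    (a_rec : forall n : nat, \sum_(i < r.+1) C i n * a (n + i)%N = 0) :
  let S : set R[i] := [set alpha | exists i : 'I_r.+1, root (chi i) alpha] in
  exists (r' : nat) (q : R[i] -> nat -> {poly R[i]}) (Rx : {poly R[i]}),
    [/\ (r' <= k)%N,
        (forall (alpha : R[i]) (t : nat), S alpha -> (t <= r')%N ->
           (size (q alpha t) <= (r + k).+1)%N),
        (size Rx <= r)%N,
        (exists (alpha : R[i]) (t : nat),
           [/\ S alpha, (t <= r')%N & q alpha t <> 0]) &
        forall n : nat,
          \sum_(alpha \in S) \sum_(t < r'.+1)
             fps_polymul (q alpha t) (fps_deriv_scale t alpha a) n = Rx`_n].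
Proof.
move=> S.
have finS : finite_set S.
  have -> : S = \bigcup_(i in [set: 'I_r.+1]) [set z | root (chi i) z].
    by apply/seteqP; split=> z [j]; exists j.
  apply: bigcup_finite => [|i _]; first exact: finite_finset.
  by apply: finite_roots; apply: monic_neq0; case: (C_charpoly i).
have [S0|S0] := pselect (S 0).
  exists 0%N, (fun alpha _ => if alpha == 0 then 1 else 0), (a 0%N)%:P; split=> //.
  - by move=> alpha t _ _; case: ifP; rewrite ?size_poly0 // size_poly1.
  - (* For r = 0 the recurrence forces a_0 = 0. *)
    case: r {chi C_charpoly C_deg S finS S0} C C_lead a_rec => [|r] C C_lead a_rec.
      have := a_rec 0%N; rewrite big_ord1 => /eqP; rewrite mulf_eq0.
      rewrite (_ : ord0 = ord_max); last exact: val_inj.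
      by have /eqP/negbTE -> := C_lead 0%N; move=> /eqP /= ->; rewrite size_poly0.
    by rewrite (leq_trans (size_polyC_leq1 _)).
  - by exists 0, 0%N; split=> //; rewrite eqxx; apply/eqP; exact: oner_neq0.
  move=> n; rewrite (fsbigD1 0) //= big_ord1 eqxx fsbig1 ?addr0 => [|alpha [_ /eqP alpha0]].
    by rewrite -(expr0 'X) fps_polymulXn subn0 fps_deriv_scale0 coefC.
  by rewrite big_ord1 (negbTE alpha0) fps_polymul0.
have /choice[b bP] : forall i : 'I_r.+1, exists b : R[i] -> nat -> R[i], forall n : nat,
    C i n = \sum_(alpha \in S)
      \sum_(t < k.+1) b alpha t * ((n + i) ^_ t)%:R * alpha ^+ (n + i).
  move=> i; apply: closed_form_shift (C_deg i) => // z rz.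
  by exists i.
pose q alpha := shift_operator_coef R[i] r (fun i => b i alpha).
pose lhs n := \sum_(alpha \in S) \sum_(t < k.+1)
  fps_polymul (q alpha t) (fps_deriv_scale t alpha a) n.
exists k, q, (\poly_(n < r) lhs n); split=> //.
- by move=> alpha t _; exact: size_shift_operator_coef.
- apply: contrapT => q_eq0; apply: (C_lead 0%N); rewrite bP fsbig1 // => alpha Salpha.
  rewrite big1 // => t _; have -> : b ord_max alpha t = 0; last by rewrite !mul0r.
  rewrite -(coef_shift_operator_coef_max R[i] r (fun i => b i alpha) t).
  suff -> : shift_operator_coef R[i] r (fun i => b i alpha) t = 0 by rewrite coef0.
  apply: contrapT => q_neq0; apply: q_eq0; exists alpha, t; split=> //.
  by rewrite -ltnS.
move=> n; rewrite coef_poly; case: ltnP => // lern.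
rewrite -(subnK lern).
exact: (shift_operator_eq0 R[i] r k S (fun alpha i => b i alpha) C a).
Qed.
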